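(* Let $G$ be a finite group of nilpotency class two, and let $\mathcal G(\mathcal C)$ be the automata group generated by the Cayley machine $\mathcal C=\mathcal C(G)$ of $G$. Then $\mathcal G(\mathcal C)$ has the presentation $$\Big\langle x,\,G \ \Big|\ [x^n g x^{-n},\,h]=\prod_{j=1}^{n}x^j\,[g^{-1},h^{a_{nj}}]\,x^{-j},\quad n\in\mathbb Z^+,\ g,h\in G\Big\rangle,$$ where $[g,h]=g^{-1}h^{-1}gh$, and $$a_{ij}=(-1)^{i-j-1}2^{2j-i}C_{j-1}^{i-j-1}-(-1)^{i-j}2^{2j-i-1}C_{j-1}^{i-j},$$ where $C_l^m$ is the binomial coefficient ''$l$ choose $m$'' for $0\le m\le l$ and $C_l^m=0$ otherwise.
   Context: Let $G$ be a finite group. The Cayley machine $\mathcal C=\mathcal C(G)$ is the automaton with state set $G$ and alphabet $G$ in which, at state $g$ on input $a\in G$, the machine goes to state $ga$ and outputs $ga$. Each state $g\in G$ thus defines a map $\mathcal C_g$ on the set $G^\omega$ of right infinite words over $G$, namely $$\mathcal C_g(a_1a_2a_3\cdots)=(ga_1)(ga_1a_2)(ga_1a_2a_3)\cdots,$$ and $\mathcal C_g$ is a bijection. The automata group $\mathcal G(\mathcal C)$ generated by the Cayley machine is the group of bijections of $G^\omega$ (under composition, $(\alpha\beta)(w)=\alpha(\beta(w))$) generated by $\{\mathcal C_g : g\in G\}$. The notation $\langle x, G\mid R\rangle$ means the quotient of the free product $\langle x\rangle * G$ (with $\langle x\rangle$ infinite cyclic) by the normal closure of the relations $R$; i.e.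 the relations of $G$ itself are included. The element $[g^{-1},h^{a_{nj}}]$ is a commutator computed in $G$. $\mathbb Z^+$ denotes the positive integers. *)

(* Defs.v *)
From HB Require Import structures.
From mathcomp Require Import all_boot all_order all_algebra.
From mathcomp Require Import all_fingroup all_solvable.
From mathcomp Require Import boolp zify.

Set Implicit Arguments.
Unset Strict Implicit.
Unset Printing Implicit Defensive.

Import GRing.Theory Num.Theory.

Local Open Scope group_scope.

(* fingroup.repr shadows the representative function of quotient types. *)
Local Notation qrepr := generic_quotient.repr.

Definition zexpg (G : groupType) (h : G) (k : int) : G :=
  match k with Posz n => h ^+ n | Negz n => h ^- n.+1 end.

Inductive generated (G : groupType) (S : G -> Prop) : G -> Prop :=
| Gen_base x of S x : generated S x
| Gen_one : generated S 1
| Gen_mul x y of generated S x & generated S y : generated S (x * y)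
| Gen_inv x of generated S x : generated S x^-1.

Section GeneratedGroup.
Variables (G : groupType) (S : G -> Prop).

Definition gen_pred : {pred G} := fun x => `[< generated S x >].

Record gen_group := GenGroup { gen_val : G; _ : gen_val \in gen_pred }.

HB.instance Definition _ := [isSub for gen_val].
HB.instance Definition _ := [Choice of gen_group by <:].

Fact gen_group_closed : group_closed gen_pred.
Proof.
split; first by apply/asboolP; exact: Gen_one.
move=> x y /asboolP Sx /asboolP Sy; apply/asboolP.
by apply: Gen_mul => //; apply: Gen_inv.
Qed.

HB.instance Definition _ :=
  SubChoice_isSubGroup.Build G gen_pred gen_group gen_group_closed.

End GeneratedGroup.

Section NormalClosure.
Variables (G : groupType) (R : G -> Prop).

Definition nclosure : G -> Prop :=
  generated (fun y => exists r w : G, R r /\ y = r ^ w).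

Lemma nclosureJ x w : nclosure x -> nclosure (x ^ w).
Proof.
elim=> [y [r [v [Rr ->]]]||y z _ IHy _ IHz|y _ IHy].
- by apply: Gen_base; exists r, (v * w); split; rewrite // conjgM.
- by rewrite conj1g; apply: Gen_one.
- by rewrite conjMg; apply: Gen_mul.
- by rewrite conjVg; apply: Gen_inv.
Qed.

Definition nclosure_rel : rel G := fun u v => `[< nclosure (u^-1 * v) >].

Fact nclosure_rel_refl : reflexive nclosure_rel.
Proof. by move=> u; apply/asboolP; rewrite mulVg; apply: Gen_one. Qed.

Fact nclosure_rel_sym : symmetric nclosure_rel.
Proof.
by move=> u v; apply/asboolP/asboolP => /Gen_inv; rewrite invgM invgK.
Qed.

Fact nclosure_rel_trans : transitive nclosure_rel.
Proof.
move=> v u w /asboolP uv /asboolP vw; apply/asboolP.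
by have := Gen_mul uv vw; rewrite -mulgA mulVKg.
Qed.

Canonical nclosure_equiv :=
  EquivRel nclosure_rel nclosure_rel_refl nclosure_rel_sym nclosure_rel_trans.

Local Open Scope quotient_scope.

Definition quo_group := {eq_quot nclosure_rel}.

HB.instance Definition _ := Choice.on quo_group.
HB.instance Definition _ := EqQuotient.on quo_group.

Definition quo_pi (u : G) : quo_group := \pi_quo_group u.

Lemma quo_piP u v : quo_pi u = quo_pi v <-> nclosure (u^-1 * v).
Proof.
rewrite /quo_pi; split=> [/eqmodP/asboolP // | Nuv].
by apply/eqmodP/asboolP.
Qed.

Definition quo_one : quo_group := quo_pi 1.
Definition quo_mul (a b : quo_group) : quo_group := quo_pi (qrepr a * qrepr b).
Definition quo_inv (a : quo_group) : quo_group := quo_pi (qrepr a)^-1.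

Lemma quo_piK a : quo_pi (qrepr a) = a.
Proof. exact: reprK. Qed.

Lemma quo_piM u v : quo_pi (u * v) = quo_mul (quo_pi u) (quo_pi v).
Proof.
have /quo_piP Nu : quo_pi u = quo_pi (qrepr (quo_pi u)) by rewrite quo_piK.
have /quo_piP Nv : quo_pi v = quo_pi (qrepr (quo_pi v)) by rewrite quo_piK.
apply/quo_piP; set u' := qrepr _ in Nu *; set v' := qrepr _ in Nv *.
suff -> : (u * v)^-1 * (u' * v') = (u^-1 * u') ^ v * (v^-1 * v').
  by apply: Gen_mul Nv; apply: nclosureJ.
by rewrite /conjg invgM !mulgA mulgK.
Qed.

Lemma quo_piV u : quo_pi u^-1 = quo_inv (quo_pi u).
Proof.
have /quo_piP Nu : quo_pi u = quo_pi (qrepr (quo_pi u)) by rewrite quo_piK.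
apply/quo_piP; set u' := qrepr _ in Nu *.
suff -> : u^-1^-1 * u'^-1 = (u^-1 * u')^-1 ^ u^-1.
  by apply: nclosureJ; apply: Gen_inv.
by rewrite /conjg !invgM !invgK !mulgA mulgK.
Qed.

Fact quo_mulA : associative quo_mul.
Proof.
by move=> a b c; rewrite -(quo_piK a) -(quo_piK b) -(quo_piK c) -!quo_piM mulgA.
Qed.

Fact quo_mul1 : left_id quo_one quo_mul.
Proof. by move=> a; rewrite -(quo_piK a) -quo_piM mul1g. Qed.

Fact quo_mulr1 : right_id quo_one quo_mul.
Proof. by move=> a; rewrite -(quo_piK a) -quo_piM mulg1. Qed.

Fact quo_mulV : left_inverse quo_one quo_inv quo_mul.
Proof. by move=> a; rewrite -(quo_piK a) -quo_piV -quo_piM mulVg. Qed.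

Fact quo_mulrV : right_inverse quo_one quo_inv quo_mul.
Proof. by move=> a; rewrite -(quo_piK a) -quo_piV -quo_piM mulgV. Qed.

HB.instance Definition _ :=
  isGroup.Build quo_group quo_mulA quo_mul1 quo_mulr1 quo_mulV quo_mulrV.

End NormalClosure.

(* The free product H * K: words in the letters H + K modulo the congruence   *)
(* generated by the multiplication tables of the two factors.                 *)
Section FreeProduct.
Variables H K : groupType.

Notation fp_word := (seq (H + K)).

Inductive fp_eq : fp_word -> fp_word -> Prop :=
| Fp_refl u : fp_eq u u
| Fp_sym u v of fp_eq u v : fp_eq v u
| Fp_trans u v w of fp_eq u v & fp_eq v w : fp_eq u w
| Fp_cat u u' v v' of fp_eq u u' & fp_eq v v' : fp_eq (u ++ v) (u' ++ v')
| Fp_onel : fp_eq [:: inl 1] [::]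
| Fp_oner : fp_eq [:: inr 1] [::]
| Fp_mull a b : fp_eq [:: inl a; inl b] [:: inl (a * b)]
| Fp_mulr a b : fp_eq [:: inr a; inr b] [:: inr (a * b)].

Definition fp_rel : rel fp_word := fun u v => `[< fp_eq u v >].

Fact fp_rel_refl : reflexive fp_rel.
Proof. by move=> u; apply/asboolP; apply: Fp_refl. Qed.

Fact fp_rel_sym : symmetric fp_rel.
Proof. by move=> u v; apply/asboolP/asboolP; apply: Fp_sym. Qed.

Fact fp_rel_trans : transitive fp_rel.
Proof.
by move=> v u w /asboolP uv /asboolP vw; apply/asboolP; apply: Fp_trans uv vw.
Qed.

Canonical fp_equiv := EquivRel fp_rel fp_rel_refl fp_rel_sym fp_rel_trans.

Local Open Scope quotient_scope.

Definition free_product := {eq_quot fp_rel}.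

HB.instance Definition _ := Choice.on free_product.
HB.instance Definition _ := EqQuotient.on free_product.

Definition fp_pi (u : fp_word) : free_product := \pi_free_product u.

Lemma fp_piP u v : fp_pi u = fp_pi v <-> fp_eq u v.
Proof.
rewrite /fp_pi; split=> [/eqmodP/asboolP // | Nuv].
by apply/eqmodP/asboolP.
Qed.

Definition fp_letterV (l : H + K) : H + K :=
  match l with inl a => inl a^-1 | inr b => inr b^-1 end.

Definition fp_wordV (u : fp_word) : fp_word := rev (map fp_letterV u).

Definition fp_one : free_product := fp_pi [::].
Definition fp_mul (a b : free_product) : free_product :=
  fp_pi (qrepr a ++ qrepr b).
Definition fp_inv (a : free_product) : free_product := fp_pi (fp_wordV (qrepr a)).

Lemma fp_piK a : fp_pi (qrepr a) = a.
Proof. exact: reprK. Qed.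

Lemma fp_piM u v : fp_pi (u ++ v) = fp_mul (fp_pi u) (fp_pi v).
Proof.
have /fp_piP Nu : fp_pi u = fp_pi (qrepr (fp_pi u)) by rewrite fp_piK.
have /fp_piP Nv : fp_pi v = fp_pi (qrepr (fp_pi v)) by rewrite fp_piK.
by apply/fp_piP; apply: Fp_cat.
Qed.

Lemma fp_eqV u v : fp_eq u v -> fp_eq (fp_wordV u) (fp_wordV v).
Proof.
rewrite /fp_wordV.
elim=> {u v} [u|u v _ IH|u v w _ IH1 _ IH2|u u' v v' _ IH1 _ IH2|||a b|a b] /=.
- exact: Fp_refl.
- exact: Fp_sym.
- exact: Fp_trans IH1 IH2.
- by rewrite !map_cat !rev_cat; apply: Fp_cat.
- by rewrite invg1; apply: Fp_onel.
- by rewrite invg1; apply: Fp_oner.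
- by rewrite invgM; apply: Fp_mull.
- by rewrite invgM; apply: Fp_mulr.
Qed.

Lemma fp_piV u : fp_pi (fp_wordV u) = fp_inv (fp_pi u).
Proof.
have /fp_piP Nu : fp_pi u = fp_pi (qrepr (fp_pi u)) by rewrite fp_piK.
by apply/fp_piP; apply: fp_eqV.
Qed.

Lemma fp_wordVK : involutive fp_wordV.
Proof.
move=> u; rewrite /fp_wordV map_rev revK -map_comp -[RHS]map_id.
by apply: eq_map => -[a|b] /=; rewrite invgK.
Qed.

Lemma fp_eq_mulV u : fp_eq (fp_wordV u ++ u) [::].
Proof.
elim: u => [|l u IHu]; first exact: Fp_refl.
rewrite /fp_wordV /= rev_cons cat_rcons -cat1s -/(fp_wordV u).
rewrite -[fp_wordV u ++ _]/(_ ++ ([:: fp_letterV l] ++ ([:: l] ++ u))).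
rewrite (catA [:: fp_letterV l]); apply: Fp_trans IHu.
apply: Fp_cat; first exact: Fp_refl.
rewrite -[X in fp_eq _ X]cat0s; apply: Fp_cat; last exact: Fp_refl.
case: l => [a|b] /=.
- by apply: Fp_trans (Fp_mull _ _) _; rewrite mulVg; apply: Fp_onel.
- by apply: Fp_trans (Fp_mulr _ _) _; rewrite mulVg; apply: Fp_oner.
Qed.

Fact fp_mulA : associative fp_mul.
Proof.
by move=> a b c; rewrite -(fp_piK a) -(fp_piK b) -(fp_piK c) -!fp_piM catA.
Qed.

Fact fp_mul1 : left_id fp_one fp_mul.
Proof. by move=> a; rewrite -(fp_piK a) -fp_piM. Qed.

Fact fp_mulr1 : right_id fp_one fp_mul.
Proof. by move=> a; rewrite -(fp_piK a) -fp_piM cats0. Qed.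

Fact fp_mulV : left_inverse fp_one fp_inv fp_mul.
Proof.
by move=> a; rewrite -(fp_piK a) -fp_piV -fp_piM; apply/fp_piP/fp_eq_mulV.
Qed.

Fact fp_mulrV : right_inverse fp_one fp_inv fp_mul.
Proof.
move=> a; rewrite -(fp_piK a) -fp_piV -fp_piM; apply/fp_piP.
by rewrite -{1}(fp_wordVK (qrepr a)); apply: fp_eq_mulV.
Qed.

HB.instance Definition _ :=
  isGroup.Build free_product fp_mulA fp_mul1 fp_mulr1 fp_mulV fp_mulrV.

Definition fp_inl (a : H) : free_product := fp_pi [:: inl a].
Definition fp_inr (b : K) : free_product := fp_pi [:: inr b].

Fact fp_inlM : {morph fp_inl : a b / a * b}.
Proof. by move=> a b; rewrite /mul /= -fp_piM; apply/fp_piP/Fp_sym/Fp_mull. Qed.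

Fact fp_inrM : {morph fp_inr : a b / a * b}.
Proof. by move=> a b; rewrite /mul /= -fp_piM; apply/fp_piP/Fp_sym/Fp_mulr. Qed.

HB.instance Definition _ := isMultiplicative.Build H free_product fp_inl fp_inlM.
HB.instance Definition _ := isMultiplicative.Build K free_product fp_inr fp_inrM.

End FreeProduct.

(* The infinite cyclic group, as the additive group of int. *)
Definition inf_cyclic := int.

HB.instance Definition _ := Choice.on inf_cyclic.
HB.instance Definition _ := isGroup.Build inf_cyclic
  (@addrA int) (@add0r int) (@addr0 int) (@addNr int) (@addrN int).

Definition inf_cyclic_gen : inf_cyclic := Posz 1.

(* (alpha * beta) w = alpha (beta w), opposite to the convention of perm.v. *)
Section Bijections.
Variable T : Type.

Record bij_on := BijOn {
  bij_fun :> T -> T;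
  bij_inv : T -> T;
  bij_funK : cancel bij_fun bij_inv;
  bij_invK : cancel bij_inv bij_fun }.

Lemma bij_on_inj (f g : bij_on) : f =1 g -> f = g.
Proof.
case: f g => [f f' fK f'K] [g g' gK g'K] /= /funext efg; case: g / efg gK g'K.
move=> gK g'K; have ef' : f' = g' by apply: funext => x; rewrite -{1}(g'K x) fK.
by case: g' / ef' gK g'K => gK g'K; congr BijOn; apply: Prop_irrelevance.
Qed.

HB.instance Definition _ := gen_eqMixin bij_on.
HB.instance Definition _ := gen_choiceMixin bij_on.

Definition bij_one : bij_on := @BijOn id id (fun=> erefl) (fun=> erefl).
Definition bij_mul (f g : bij_on) : bij_on :=
  BijOn (can_comp (bij_funK f) (bij_funK g))
        (can_comp (bij_invK g) (bij_invK f)).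
Definition bij_opp (f : bij_on) : bij_on := BijOn (bij_invK f) (bij_funK f).

Fact bij_mulA : associative bij_mul.
Proof. by move=> f g h; apply: bij_on_inj. Qed.
Fact bij_mul1 : left_id bij_one bij_mul.
Proof. by move=> f; apply: bij_on_inj. Qed.
Fact bij_mulr1 : right_id bij_one bij_mul.
Proof. by move=> f; apply: bij_on_inj. Qed.
Fact bij_mulV : left_inverse bij_one bij_opp bij_mul.
Proof. by move=> f; apply: bij_on_inj => x; apply: bij_funK. Qed.
Fact bij_mulrV : right_inverse bij_one bij_opp bij_mul.
Proof. by move=> f; apply: bij_on_inj => x; apply: bij_invK. Qed.

HB.instance Definition _ :=
  isGroup.Build bij_on bij_mulA bij_mul1 bij_mulr1 bij_mulV bij_mulrV.

Lemma bij_mulE (f g : bij_on) x : (f * g) x = f (g x).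
Proof. by []. Qed.

End Bijections.

Definition omega_word (A : Type) := nat -> A.

Record automaton (Q A : Type) := Automaton {
  next_state : Q -> A -> Q;
  output : Q -> A -> A }.

Section Automaton.
Variables (Q A : Type) (M : automaton Q A).

Fixpoint run_state (q : Q) (w : omega_word A) (n : nat) : Q :=
  if n is n'.+1 then next_state M (run_state q w n') (w n') else q.

Definition state_map (q : Q) (w : omega_word A) : omega_word A :=
  fun n => output M (run_state q w n) (w n).

End Automaton.

Section CayleyMachine.
Variable gT : finGroupType.

Definition cayley_machine : automaton gT gT :=
  Automaton (fun g a => g * a) (fun g a => g * a).

Lemma cayley_state_mapE (g : gT) (w : omega_word gT) n :
  state_map cayley_machine g w n = g * \prod_(0 <= i < n.+1) w i.
Proof.
rewrite /state_map /=; elim: n => [|n IHn]; first by rewrite big_nat1.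
by rewrite big_nat_recr //= mulgA -IHn.
Qed.

Definition cayley_map_inv (g : gT) (w : omega_word gT) : omega_word gT :=
  fun n => if n is n'.+1 then (w n')^-1 * w n else g^-1 * w 0.

Fact cayley_mapK g : cancel (state_map cayley_machine g) (cayley_map_inv g).
Proof.
move=> w; apply: funext => -[|n]; rewrite /cayley_map_inv /state_map /=.
  by rewrite mulKg.
by rewrite mulKg.
Qed.

Fact cayley_map_invK g : cancel (cayley_map_inv g) (state_map cayley_machine g).
Proof.
move=> w; apply: funext => n; rewrite cayley_state_mapE.
elim: n => [|n IHn]; first by rewrite big_nat1 /= mulVKg.
by rewrite big_nat_recr // mulgA IHn /= mulVKg.
Qed.

Definition cayley_bij (g : gT) : bij_on (omega_word gT) :=
  BijOn (cayley_mapK g) (@cayley_map_invK g).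

Definition cayley_automata_group : groupType :=
  gen_group (fun f : bij_on (omega_word gT) => exists g, f = cayley_bij g).

End CayleyMachine.

(* C_l^m, extended by 0 outside of 0 <= m <= l. *)
Definition binz (l m : int) : int :=
  if ((0 <= m) && (m <= l))%R then Posz 'C(`|l|, `|m|) else 0%R.

(* Whenever an exponent of 2 is negative the binomial factor is 0, so that    *)
(* computing in int rather than in rat is harmless: see coefa_rat.            *)
Definition coefa (i j : nat) : int :=
  let i := Posz i in let j := Posz j in
  ((-1) ^ (i - j - 1) * 2 ^ (2 * j - i) * binz (j - 1) (i - j - 1)
   - (-1) ^ (i - j) * 2 ^ (2 * j - i - 1) * binz (j - 1) (i - j))%R.

Lemma pow2_binz_rat (k l m : int) : (m <= l -> 0 <= k)%R ->
  ((2 ^ k * binz l m)%:~R = 2%:Q ^ k * (binz l m)%:~R :> rat)%R.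
Proof.
rewrite rmorphM /= /binz => Hk; case: ifP => [/andP[_ /Hk]|_].
  by case: k {Hk} => // n _; rewrite -exprnP rmorphXn.
by rewrite !mulr0.
Qed.

Lemma sign_rat (k : int) : (((-1) ^ k)%:~R = (-1) ^ k :> rat)%R.
Proof. by rewrite rmorphXz ?rmorphN1 ?unitrN1. Qed.

Lemma coefa_rat (i' j' : nat) : let i := Posz i' in let j := Posz j' in
  ((coefa i' j')%:~R =
     (-1) ^ (i - j - 1) * 2%:Q ^ (2 * j - i) * (binz (j - 1) (i - j - 1))%:~R
     - (-1) ^ (i - j) * 2%:Q ^ (2 * j - i - 1) * (binz (j - 1) (i - j))%:~R
   :> rat)%R.
Proof.
move=> i j; rewrite /coefa -/i -/j rmorphB -!mulrA.
rewrite !(rmorphM _ ((-1) ^ _)%R) /= !sign_rat !pow2_binz_rat //; lia.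
Qed.

Section Presentation.
Variable gT : finGroupType.

Local Notation F := (free_product inf_cyclic gT).
Local Notation x := (fp_inl gT inf_cyclic_gen : F).
Local Notation "\g g" := (fp_inr inf_cyclic g : F) (at level 8, format "\g g").

Definition cayley_relator (r : F) : Prop :=
  exists (n : nat) (g h : gT), (0 < n)%N /\
    r = [~ x ^+ n * \g g * x ^- n, \g h] *
        (\prod_(1 <= j < n.+1)
           (x ^+ j * \g [~ g^-1, zexpg h (coefa n j)] * x ^- j))^-1.

Definition cayley_presented_group : groupType := quo_group cayley_relator.

End Presentation.

(* Main.v *)
Require Import Defs.
From HB Require Import structures.
From mathcomp Require Import all_boot all_order all_algebra.
From mathcomp Require Import all_fingroup all_solvable.
From mathcomp Require Import boolp zify ring.

(** Let P = C_1 be the map taking a word to the word of its prefix products,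
    x = P^-1, and L_g the map multiplying every letter by g, so that
    C_g = L_g P and the automata group is generated by x and the L_g. The
    presentation map sends x to P^-1 and g to L_g. Conjugation u |-> x u x^-1
    is written u ^ P throughout, and x^n L_g x^-n is [shifted n g].

    The relations hold. Twists, which multiply the i-th letter by c^(f i) for a
    fixed central c and an integer sequence f, form an abelian group on which
    conjugation by x acts as the difference operator dif f i = f i - f (i - 1).
    One shows that [x^n g x^-n, h] is the twist of c = [g, h] by a sequence F_n
    with F_0 = 1, F_1 = (1, 0, 0, ...) and F_(n+2) = 2 dif F_(n+1) - dif F_n
    ([shifted_comm]). Separating the first letter a of a word from its tail,
    x^n L_g x^-n multiplies a by g and acts on the tail by
      L_g (prod_(k < n) (x^k L_g x^-k)^-1) . twist [g, a] rho_n,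
    which expresses the commutator at level n through those at lower levels
    ([wreath_shifted], [comm_exp_tail]). Pascal's rule shows that the a_nj obey
    a_(n+2, j+1) = 2 a_(n+1, j) - a_(n, j), so that F_n is
    - sum_j a_nj dif^j F_0 ([comm_exp_coefa]); as the twist of c by dif^j F_0 is
    the conjugate x^j L_c x^-j, this is exactly the relation.

    The relations suffice. In the presented group they make the conjugates of a
    central element commute with every x^m g x^-m, and every commutator
    [x^m g x^-m, h] with m > 0 a product of x^j c x^-j with 0 < j and c central.
    Hence products of elements x^j g x^-j with j > 0 can be collected by
    increasing j, and each element takes the form
      x^-m (x g_1 x^-1) (x^2 g_2 x^-2) ... (x^k g_k x^-k) x^n
    ([pres_normal_form]). Acting on words, the middle factor only changes the
    first k letters, whereas a nontrivial power of x moves the last nontrivial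
    letter of a word; and the k-th letter is only changed by the last factor. So
    an element of this form acts trivially only if m = n and all g_i are trivial
    ([shift_form_torsion], [shift_form_faithful]). *)

Set Implicit Arguments.
Unset Strict Implicit.
Unset Printing Implicit Defensive.

Import GRing.Theory Num.Theory.

Local Open Scope group_scope.

(** * Integer powers and commutators in class two *)

Section IntegerPowers.
Variable G : groupType.
Implicit Types (c d h : G) (k l : int).

Lemma zexpgS h k : zexpg h (k + 1)%R = h * zexpg h k.
Proof.
case: k => n.
  have -> : (Posz n + 1 = Posz n.+1)%R by lia.
  by rewrite /= expgS.
case: n => [|n]; first by rewrite /= expg1 mulgV.
have -> : (Negz n.+1 + 1 = Negz n)%R by lia.
by rewrite /= [h ^+ n.+2]expgSr invgM mulVKg.
Qed.

Lemma zexpgD h k l : zexpg h (k + l)%R = zexpg h k * zexpg h l.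
Proof.
elim/int_rect: k => [|n IHn|n IHn]; first by rewrite add0r mul1g.
  have -> : (Posz n.+1 = Posz n + 1)%R by lia.
  by rewrite -addrAC !zexpgS -mulgA -IHn.
apply: (@mulgI _ h); rewrite mulgA -!zexpgS.
have -> : (- (Posz n.+1) + l + 1 = - Posz n + l)%R by lia.
by have -> : (- (Posz n.+1) + 1 = - Posz n)%R by lia.
Qed.

Lemma zexpg1 h : zexpg h 1 = h. Proof. by []. Qed.

Lemma zexpgM h k l : zexpg h (k * l)%R = zexpg (zexpg h k) l.
Proof.
elim/int_rect: l => [|n IHn|n IHn]; first by rewrite mulr0.
  have -> : (Posz n.+1 = Posz n + 1)%R by lia.
  by rewrite zexpgS -IHn -zexpgD; congr zexpg; lia.
apply: (@mulgI _ (zexpg h k)); rewrite -zexpgS -zexpgD.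
have -> : (- (Posz n.+1) + 1 = - Posz n)%R by lia.
by rewrite -IHn; congr zexpg; lia.
Qed.

Lemma zexpgV h k : zexpg h^-1 k = zexpg h (- k)%R.
Proof. by rewrite -[h^-1]/(zexpg h (-1)) -zexpgM mulN1r. Qed.

Lemma commute_zexpg c h k : commute h c -> commute h (zexpg c k).
Proof.
case: k => n ch /=; first exact: commuteX.
by apply: commuteV; apply: commuteX.
Qed.

Lemma zexpgMn c d k : commute c d -> zexpg (c * d) k = zexpg c k * zexpg d k.
Proof.
move=> cd; elim/int_rect: k => [|n IHn|n IHn]; first by rewrite mulg1.
  have -> : (Posz n.+1 = Posz n + 1)%R by lia.
  rewrite !zexpgS IHn -!mulgA; congr (_ * _).
  by rewrite !mulgA (commute_zexpg _ (commute_sym cd)).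
apply: (@mulgI _ (c * d)); rewrite -zexpgS.
have -> : (- (Posz n.+1) + 1 = - Posz n)%R by lia.
have E (a : G) : zexpg a (- Posz n)%R = a * zexpg a (- Posz n.+1)%R.
  by rewrite -zexpgS; congr zexpg; lia.
rewrite IHn !E -!mulgA; congr (_ * _); rewrite !mulgA.
by rewrite (commute_zexpg _ (commute_sym cd)).
Qed.

End IntegerPowers.

Section ClassTwo.
Variable G : groupType.
Hypothesis commg_central : forall a b c : G, commute [~ a, b] c.
Implicit Types (g h a : G) (k : int).

Lemma commMg_class2 g h a : [~ g * h, a] = [~ g, a] * [~ h, a].
Proof.
have -> : [~ g * h, a] = [~ g, a] ^ h * [~ h, a].
  by rewrite /commg /conjg !invgM !mulgA !(mulgK, mulgVK).
by rewrite /conjg commg_central mulKg.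
Qed.

Lemma commVg_class2 g a : [~ g^-1, a] = [~ g, a]^-1.
Proof.
apply: (@mulIg _ [~ g, a]); rewrite -commMg_class2 !mulVg.
by apply/eqP/commgP; apply/commute_sym/commute1.
Qed.

Lemma commgM_class2 a g h : [~ a, g * h] = [~ a, g] * [~ a, h].
Proof. by rewrite -invgR commMg_class2 invgM !invgR commg_central. Qed.

Lemma commgV_class2 a g : [~ a, g^-1] = [~ a, g]^-1.
Proof. by rewrite -invgR commVg_class2 !invgR. Qed.

Lemma commg_zexpg a g k : [~ a, zexpg g k] = zexpg [~ a, g] k.
Proof.
elim/int_rect: k => [|n IHn|n IHn]; first by rewrite commg1.
  have -> : (Posz n.+1 = Posz n + 1)%R by lia.
  by rewrite !zexpgS commgM_class2 IHn.
have -> : (- (Posz n.+1) = - 1 - Posz n)%R by lia.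
by rewrite !zexpgD commgM_class2 commgV_class2 IHn.
Qed.

End ClassTwo.

(** * The exponent sequences of the commutators *)

(** Multiplication by 1 - t on generating series. *)
Definition dif (f : nat -> int) (i : nat) : int :=
  (f i - (if i is j.+1 then f j else 0))%R.

(** The sequences F_n; [shifted_comm] identifies them as the exponents of
    [x^n g x^-n, h]. *)
Fixpoint comm_exp (n : nat) : nat -> int :=
  match n with
  | 0 => fun=> 1%R
  | n1.+1 =>
    match n1 with
    | 0 => fun i => Posz (i == 0)
    | n2.+1 => fun i => (2 * dif (comm_exp n1) i - dif (comm_exp n2) i)%R
    end
  end.

(** The exponents rho_n of the twist in the action of x^n g x^-n on tails; see
    [shifted_section]. *)
Definition sect_exp (n : nat) : nat -> int :=
  if n is m.+1 then dif (fun i => comm_exp m i.+1 - 1)%R else fun=> 0%R.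

Lemma comm_expSS n i :
  comm_exp n.+2 i = (2 * dif (comm_exp n.+1) i - dif (comm_exp n) i)%R.
Proof. by []. Qed.

Lemma comm_exp0 n : comm_exp n 0 = 1%R.
Proof.
elim/ltn_ind: n => -[|[|n]] IH //.
by rewrite comm_expSS /dif !IH.
Qed.

(** This is the exponent count when the commutator of x^n g x^-n with h is read
    off the tail of a word: rho_n comes from the change of first letter, the
    term 1 from L_g, and the sum from the factors (x^k g x^-k)^-1. The two sides
    satisfy the same recursion because F_n is 1 followed by its own tail. *)
Lemma comm_exp_tail n i : comm_exp n i.+1 =
  (sect_exp n i + 1 - \sum_(0 <= k < n) comm_exp k i)%R.
Proof.
elim: n => [|[|n] IH]; first by rewrite big_geq.
  by rewrite big_nat1 /= /dif; case: i {IH}.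
have -> : (\sum_(0 <= k < n.+2) comm_exp k i =
           \sum_(0 <= k < n.+1) comm_exp k i + comm_exp n.+1 i)%R.
  exact: big_nat_recr.
rewrite comm_expSS; move: IH; rewrite /sect_exp /dif.
by case: i => [|i]; rewrite ?comm_exp0; lia.
Qed.

(** The coefficient of z^m in (2 - z)^l; the integer a_ij is a difference of two
    such coefficients, so its recurrence is Pascal's rule. *)
Definition sbin (l m : int) : int := ((-1) ^ m * 2 ^ (l - m) * binz l m)%R.

Lemma sign_pred (m : int) : ((-1) ^ (m - 1) = - (-1) ^ m :> int)%R.
Proof. by rewrite exprzDr ?unitrN1 // -[((-1) ^ (-1))%R]/(-1)%R mulrN1. Qed.

Lemma coefa_sbin i j (m : int) : (Posz i - Posz j = m)%R ->
  coefa i j = (sbin (Posz j - 1) (m - 1) - sbin (Posz j - 1) m)%R.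
Proof.
move=> ijm; rewrite /coefa /sbin -ijm.
by congr (_ * (2 ^ _) * _ - _ * (2 ^ _) * _)%R; lia.
Qed.

Lemma binz_nat (l m : nat) : binz l m = Posz 'C(l, m).
Proof. by rewrite /binz /=; case: ifP => // lm; rewrite bin_small //; lia. Qed.

Lemma binz_neg (l m : int) : (m < 0)%R -> binz l m = 0%R.
Proof. by rewrite /binz; case: ifP => //; lia. Qed.

Lemma sbin_pascal (l : nat) (m : int) :
  sbin (l + 1)%N m = (2 * sbin l m - sbin l (m - 1))%R.
Proof.
rewrite /sbin sign_pred; case: m => m; last by rewrite !binz_neg //; lia.
case: m => [|m].
  rewrite [binz l (0 - 1)]binz_neg // !binz_nat !bin0 !mulr1 mulr0 subr0 !subr0.
  by rewrite !expr0z !mul1r addn1 -exprSz.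
have -> : (Posz m.+1 - 1 = m)%R by lia.
rewrite !binz_nat addn1 binS PoszD.
have -> : (Posz l.+1 - Posz m.+1 = Posz l - Posz m)%R by lia.
set s := (_ ^ _)%R; rewrite !mulNr opprK mulrDr.
congr (_ + _)%R.
case: (ltngtP m l) => ml.
- have -> : (Posz l - Posz m = (l - m.+1).+1)%R by lia.
  have -> : (Posz l - Posz m.+1 = (l - m.+1)%N)%R by lia.
  by rewrite exprSz; ring.
- by rewrite bin_small ?mulr0 //; lia.
- by rewrite bin_small ?mulr0 //; lia.
Qed.

Lemma coefa_rec i j : (0 < j)%N ->
  coefa i.+2 j.+1 = (2 * coefa i.+1 j - coefa i j)%R.
Proof.
case: j => // j _.
set m : int := (Posz i - Posz j)%R.
rewrite (@coefa_sbin i.+2 _ m) ?(@coefa_sbin i.+1 _ m); try by rewrite /m; lia.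
rewrite (@coefa_sbin i _ (m - 1)%R); last by rewrite /m; lia.
have -> : (Posz j.+2 - 1 = (j + 1)%N)%R by lia.
have -> : (Posz j.+1 - 1 = j)%R by lia.
by rewrite !sbin_pascal; ring.
Qed.

Lemma coefa_gt i j : (i < j)%N -> coefa i j = 0%R.
Proof.
by move=> ij; rewrite (coefa_sbin (erefl _)) /sbin !binz_neg ?mulr0 //; lia.
Qed.

Lemma coefa_col1 i : coefa i.+3 1 = 0%R.
Proof.
rewrite (@coefa_sbin _ _ (Posz i.+2)); last by lia.
have -> : (Posz i.+2 - 1 = i.+1)%R by lia.
by rewrite /sbin subrr !binz_nat !bin0n !mulr0.
Qed.

(** Both sides satisfy the recurrence defining F_n, by [coefa_rec]; the first
    column of the a_nj vanishes from n = 3 on. *)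
Lemma comm_exp_coefa n i : (0 < n)%N ->
  comm_exp n i = (- \sum_(1 <= j < n.+1) coefa n j * iter j dif (fun=> 1) i)%R.
Proof.
elim/ltn_ind: n i => -[|[|[|n]]] // IH i _.
- by rewrite big_nat1 /= /dif; case: i.
- rewrite big_nat_recl // big_nat1.
  have -> : coefa 2 1 = 1%R by [].
  have -> : coefa 2 2 = (-2)%R by [].
  by rewrite comm_expSS /= /dif; case: i => [|[|i]] //=.
rewrite comm_expSS big_ltn // coefa_col1 mul0r add0r big_add1 -[n.+4.-1]/(n.+3).
have difS m : (0 < m)%N -> (m < n.+3)%N -> dif (comm_exp m) i =
   (- \sum_(1 <= j < n.+3) coefa m j * iter j.+1 dif (fun=> 1) i)%R.
  move=> m0 mn.
  have E k : comm_exp m k =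
      (- \sum_(1 <= j < n.+3) coefa m j * iter j dif (fun=> 1) k)%R.
    rewrite IH // [in RHS](big_cat_nat (n := m.+1)) //=.
    rewrite [X in (_ + X)%R]big_nat_cond [X in (_ + X)%R]big1 ?addr0 // => j.
    by case/andP=> /andP[mj _] _; rewrite coefa_gt ?mul0r.
  rewrite /dif; case: i => [|k]; rewrite !E.
    rewrite subr0; congr (- _)%R; apply: eq_bigr => j _.
    by rewrite iterS /dif subr0.
  rewrite -opprD -sumrN -big_split /=; congr (- _)%R.
  by apply: eq_bigr => j _; rewrite /dif -mulrN -mulrDr.
rewrite !difS // ?mulrN -opprD; congr (- _)%R.
rewrite mulr_sumr -sumrB.
apply/esym/eq_big_nat => j /andP[j1 _].
by rewrite coefa_rec // iterS; ring.
Qed.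

(** The product (x g_1 x^-1) (x^2 g_2 x^-2) ... for s = [:: g_1; g_2; ...] and
    x = p^-1, in Horner form. Both the presented group and the group of
    bijections of words contain such products. *)
Definition shift_form (G A : groupType) (p : A) (gam : G -> A) (s : seq G) :=
  foldr (fun g u => (gam g * u) ^ p) 1 s.

(** * Letterwise multiplications and central twists of words *)

Section Words.
Variable gT : finGroupType.

Local Notation word := (omega_word gT).
Local Notation B := (bij_on word).
Local Notation P := (cayley_bij (1 : gT) : B).
Implicit Types (g h a c d : gT) (w : word) (T : B).

Lemma cayley_bij1S w i : P w i.+1 = P w i * w i.+1.
Proof. by []. Qed.

Lemma cayley_bij1_0 w : P w 0 = w 0.
Proof. exact: mul1g. Qed.

Lemma diff_0 w : P^-1 w 0 = w 0.
Proof. by rewrite /= invg1 mul1g. Qed.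

Lemma diff_S w i : P^-1 w i.+1 = (w i)^-1 * w i.+1.
Proof. by []. Qed.

Fact letterwiseK g : cancel (fun w i => g * w i) (fun w i => g^-1 * w i).
Proof. by move=> w; apply: funext => i; rewrite mulKg. Qed.
Fact letterwiseVK g : cancel (fun w i => g^-1 * w i) (fun w i => g * w i).
Proof. by move=> w; apply: funext => i; rewrite mulVKg. Qed.
Definition letterwise g : B := BijOn (letterwiseK g) (@letterwiseVK g).
Local Notation L := letterwise.

Lemma letterwiseE g w i : L g w i = g * w i. Proof. by []. Qed.

Lemma letterwiseM : {morph L : g h / g * h}.
Proof.
by move=> g h; apply: bij_on_inj => w; apply: funext => i; rewrite /= mulgA.
Qed.

Lemma letterwiseV g : L g^-1 = (L g)^-1.
Proof.
apply: (@mulgI _ (L g)); rewrite -letterwiseM !mulgV.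
by apply: bij_on_inj => w; apply: funext => i; rewrite /= mul1g.
Qed.

Lemma cayley_bijE g : cayley_bij g = L g * P.
Proof.
apply: bij_on_inj => w; apply: funext => i.
rewrite bij_mulE letterwiseE -[cayley_bij g w i]/(state_map _ g w i).
by rewrite -[P w i]/(state_map _ 1 w i) !cayley_state_mapE mul1g.
Qed.

Fact twist_subproof c (f f' : nat -> int) : (forall i, f i + f' i = 0)%R ->
  cancel (fun w i => zexpg c (f i) * w i) (fun w i => zexpg c (f' i) * w i).
Proof.
move=> ff' w; apply: funext => i.
by rewrite mulgA -zexpgD addrC ff' mul1g.
Qed.
Definition twist c (f : nat -> int) : B :=
  BijOn (twist_subproof c (fun i => addrN (f i)))
        (twist_subproof c (fun i => addNr (f i))).

Lemma twistE c f w i : twist c f w i = zexpg c (f i) * w i.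
Proof. by []. Qed.

Lemma twistD c f f' : twist c f * twist c f' = twist c (fun i => f i + f' i)%R.
Proof.
apply: bij_on_inj => w; apply: funext => i.
by rewrite bij_mulE !twistE zexpgD mulgA.
Qed.

Lemma twistN c f : twist c (fun i => - f i)%R = (twist c f)^-1.
Proof. exact: bij_on_inj. Qed.

Lemma eq_twist c f f' : f =1 f' -> twist c f = twist c f'.
Proof. by move=> /funext->. Qed.

Lemma twistM c d f : commute c d -> twist (c * d) f = twist c f * twist d f.
Proof.
move=> cd; apply: bij_on_inj => w; apply: funext => i.
by rewrite bij_mulE !twistE zexpgMn // mulgA.
Qed.

Lemma letterwise_twist c : L c = twist c (fun=> 1%R).
Proof. by apply: bij_on_inj => w; apply: funext => i. Qed.

Lemma twist_letterwise c f g : (forall a, commute c a) ->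
  commute (twist c f) (L g).
Proof.
move=> cZ; apply: bij_on_inj => w; apply: funext => i; rewrite !bij_mulE.
rewrite letterwiseE !twistE letterwiseE !mulgA.
by congr (_ * _); rewrite -commute_zexpg //; apply/commute_sym/cZ.
Qed.

(** In the i-th letter of x (twist c f) x^-1 w the prefix products of w cancel,
    leaving the quotient of two consecutive powers of c. *)
Lemma twistJ c f : (forall a, commute c a) -> twist c f ^ P = twist c (dif f).
Proof.
move=> cZ; apply: bij_on_inj => w; apply: funext => i.
have zZ k a : commute a (zexpg c k) by apply/commute_zexpg/commute_sym/cZ.
rewrite conjgE !bij_mulE; case: i => [|i].
  by rewrite diff_0 !twistE cayley_bij1_0 /dif subr0.
rewrite diff_S !twistE cayley_bij1S /dif.
have -> : zexpg c (f i.+1) = zexpg c (f i) * zexpg c (f i.+1 - f i)%R.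
  by rewrite -zexpgD addrC subrK.
set t := zexpg c (_ - _)%R; set u := zexpg c _; move: (P w i) => p.
have -> : u * t * (p * w i.+1) = u * p * (t * w i.+1); last by rewrite mulKg.
rewrite -!mulgA [t * (p * _)]mulgA [p * (t * _)]mulgA.
by rewrite (zZ _ p : p * t = t * p).
Qed.

Lemma twist_root c f : (forall a, commute c a) ->
  exists f', twist c f = twist c f' ^ P.
Proof.
move=> cZ; exists (fun i => \sum_(0 <= k < i.+1) f k)%R; rewrite twistJ //.
apply: eq_twist => -[|i]; rewrite /dif ?big_nat1 ?subr0 //.
have -> : (\sum_(0 <= k < i.+2) f k = \sum_(0 <= k < i.+1) f k + f i.+1)%R.
  exact: big_nat_recr.
by rewrite addrAC subrr add0r.
Qed.

Definition shifted n g : B := L g ^ P ^+ n.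

Lemma shifted0 g : shifted 0 g = L g.
Proof. by rewrite /shifted expg0 conjg1. Qed.

Lemma shiftedS n g : shifted n.+1 g = shifted n g ^ P.
Proof. by rewrite /shifted expgSr conjgM. Qed.

(** A twist is conjugate under P^n to another twist, which commutes with L_g. *)
Lemma twist_shifted c f n g : (forall a, commute c a) ->
  commute (twist c f) (shifted n g).
Proof.
move=> cZ; elim: n f => [|n IHn] f.
  by rewrite shifted0; apply: twist_letterwise.
have [f' ->] := twist_root f cZ.
by rewrite shiftedS /commute -!conjMg IHn.
Qed.

Lemma twist_iterJ c f n : (forall a, commute c a) ->
  twist c f ^ P ^+ n = twist c (iter n dif f).
Proof.
move=> cZ; elim: n => [|n IHn]; first by rewrite expg0 conjg1.
by rewrite expgSr conjgM IHn twistJ.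
Qed.

(** * Wreath recursion *)

Definition wtail w : word := fun i => w i.+1.

(** T multiplies the first letter a by g and acts on the tail by U a: the usual
    wreath decomposition of an automorphism of the tree of words, for those
    whose action on the first letter is a left multiplication. *)
Definition wreath T g (U : gT -> B) :=
  forall w, T w 0 = g * w 0 /\ wtail (T w) = U (w 0) (wtail w).

Lemma wreath_inj T T' g U U' :
  wreath T g U -> wreath T' g U' -> U =1 U' -> T = T'.
Proof.
move=> wT wT' eU; apply: bij_on_inj => w; apply: funext => i.
have [T0 TS] := wT w; have [T'0 T'S] := wT' w.
case: i => [|i]; first by rewrite T0 T'0.
by rewrite -[LHS]/(wtail (T w) i) TS eU -T'S.
Qed.

Lemma wreathM T T' g g' U U' : wreath T g U -> wreath T' g' U' ->
  wreath (T * T') (g * g') (fun a => U (g' * a) * U' a).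
Proof.
move=> wT wT' w; have [T'0 T'S] := wT' w; have [T0 TS] := wT (T' w).
by rewrite bij_mulE T0 TS T'0 T'S mulgA.
Qed.

Lemma wreath_letterwise g : wreath (L g) g (fun=> L g).
Proof. by []. Qed.

Lemma wreath_twist c f :
  wreath (twist c f) (zexpg c (f 0)) (fun=> twist c (fun i => f i.+1)).
Proof. by []. Qed.

Lemma wreath_cayley : wreath P 1 (fun a => L a * P).
Proof.
move=> w; split; first by rewrite cayley_bij1_0 mul1g.
apply: funext; elim=> [|i IHi].
  by rewrite /wtail cayley_bij1S bij_mulE letterwiseE !cayley_bij1_0.
have IH : P w i.+1 = w 0 * P (wtail w) i by exact: IHi.
rewrite bij_mulE letterwiseE -[LHS]/(P w i.+2) cayley_bij1S IH.
exact/esym/mulgA.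
Qed.

Lemma wreath_diff : wreath P^-1 1 (fun a => P^-1 * (L a)^-1).
Proof.
move=> w; split; first by rewrite diff_0 mul1g.
apply: funext => -[|i].
  by rewrite /wtail diff_S -letterwiseV bij_mulE diff_0 letterwiseE.
rewrite /wtail diff_S -letterwiseV bij_mulE diff_S !letterwiseE.
by rewrite invgM invgK -!mulgA mulVKg.
Qed.

(** * Commutators of the shifted letters *)

Hypothesis commg_central : forall a b c : gT, commute [~ a, b] c.

Definition shifted_prod n g : B := \prod_(0 <= k < n) (shifted k g)^-1.

Definition commutation n g :=
  forall h, [~ shifted n g, L h] = twist [~ g, h] (comm_exp n).

Lemma shifted_prodJ n g h : (forall k, (k < n)%N -> commutation k g) ->
  shifted_prod n g ^ L h =
  shifted_prod n g *
  twist [~ g, h] (fun i => - \sum_(0 <= k < n) comm_exp k i)%R.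
Proof.
rewrite /shifted_prod; elim: n => [|n IHn] Cn.
  rewrite big_geq // conj1g mul1g; apply: bij_on_inj => w; apply: funext => i.
  by rewrite twistE big_geq // oppr0 mul1g.
rewrite big_nat_recr //= conjMg IHn => [|k kn]; last by apply: Cn; lia.
rewrite conjVg -[shifted n g ^ L h](mulVKg (shifted n g)) -commgEl Cn //.
rewrite invgM -!mulgA; congr (_ * _); rewrite -twistN mulgA twistD.
rewrite (commuteV (twist_shifted _ _ _ _)) //.
congr (_ * _); apply: eq_twist => i.
by rewrite -opprD (@big_nat_recr _ _ _ n).
Qed.

Lemma shifted_prod_cayleyJ n g :
  shifted_prod n g ^ P = L g * shifted_prod n.+1 g.
Proof.
rewrite /shifted_prod big_nat_recl // shifted0 mulVKg conjg_prod.
by apply: eq_bigr => k _; rewrite conjVg -shiftedS.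
Qed.

Definition shifted_section n g a : B :=
  L g * shifted_prod n g * twist [~ g, a] (sect_exp n).

(** Conjugating by x turns the section U a at the first letter a into
    x L_(ga)^-1 (U a) L_a x^-1. Here L_(ga)^-1 L_g = L_a^-1, and moving L_a
    across the product costs commutators of levels k < n, which are twists of
    [g, a]. *)
Lemma wreath_shifted n g : (forall k, (k < n)%N -> commutation k g) ->
  wreath (shifted n g) g (shifted_section n g).
Proof.
elim: n => [|n IHn] Cn.
  rewrite shifted0 (_ : shifted_section 0 g = fun=> L g) //.
  apply: funext => a; rewrite /shifted_section /shifted_prod big_geq // mulg1.
  rewrite -[RHS]mulg1; congr (_ * _).
  by apply: bij_on_inj => w; apply: funext => i; rewrite /= mul1g.
have Cn' k : (k < n)%N -> commutation k g by move=> kn; apply: Cn; lia.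
have := wreathM wreath_diff (wreathM (IHn Cn') wreath_cayley).
rewrite -conjgE -shiftedS mul1g mulg1; congr wreath; apply: funext => a.
rewrite mul1g letterwiseM invgM /shifted_section.
have cZ b : commute [~ g, a] b by apply: commg_central.
have -> : P^-1 * ((L a)^-1 * (L g)^-1) *
    (L g * shifted_prod n g * twist [~ g, a] (sect_exp n) * (L a * P)) =
    ((shifted_prod n g * twist [~ g, a] (sect_exp n)) ^ L a) ^ P.
  by rewrite /conjg -!mulgA mulKg.
rewrite [in LHS](conjMg _ _ (L a)) shifted_prodJ // [twist _ _ ^ L a]/conjg.
rewrite twist_letterwise // mulKg -mulgA twistD.
rewrite conjMg shifted_prod_cayleyJ twistJ //.
congr (_ * _); apply: eq_twist => i.
rewrite -[sect_exp n.+1]/(dif (fun i => comm_exp n i.+1 - 1)%R) /dif.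
by case: i => [|i]; rewrite !comm_exp_tail; lia.
Qed.

(** Compare the wreath decompositions of (x^n L_g x^-n) L_h and of
    L_h (x^n L_g x^-n) (twist [g, h] F_n). On first letters they agree as
    F_n(0) = 1; on tails, only lower levels occur. *)
Lemma shifted_comm n g : commutation n g.
Proof.
elim/ltn_ind: n => n Cn h.
have wT := wreath_shifted Cn.
set c := [~ g, h]; have cZ b : commute c b by exact: commg_central.
apply: (@mulgI _ (L h * shifted n g)); rewrite -commgC.
have := wreathM (wreathM (wreath_letterwise h) wT)
                (wreath_twist c (comm_exp n)).
rewrite comm_exp0 zexpg1 -commgC.
move/(wreath_inj (wreathM wT (wreath_letterwise h))); apply=> a.
rewrite /shifted_section.
have -> : [~ g, c * a] = [~ g, a].
  rewrite commgM_class2 // (_ : [~ g, c] = 1) ?mul1g //.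
  by apply/eqP/commgP; apply/commute_sym/cZ.
have Z b : commute [~ g, a] b by apply: commg_central.
have J : (L g * shifted_prod n g) ^ L h = L g * shifted_prod n g *
    twist c (fun i => 1 - \sum_(0 <= k < n) comm_exp k i)%R.
  rewrite conjMg shifted_prodJ // (conjgE (L g)) -letterwiseV -!letterwiseM.
  rewrite -conjgE -[g ^ h](mulKVg g) -commgEl letterwiseM (letterwise_twist c).
  rewrite -mulgA (mulgA (twist c _)) [twist c _ * shifted_prod n g]commute_prod.
    by rewrite -!mulgA twistD.
  by move=> k _; apply: commuteV; apply: twist_shifted.
rewrite commgM_class2 // twistM // -/c -(mulgA _ _ (L h)) -(mulgA (twist c _)).
rewrite [twist [~ g, a] _ * L h]twist_letterwise //.
rewrite (mulgA (twist c _)) [twist c _ * L h]twist_letterwise //.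
rewrite -(mulgA (L h) _ (twist _ _)) !(mulgA (L g * _)) (conjgC (L g * _)) J.
rewrite -!mulgA; do 3 congr (_ * _).
rewrite mulgA twistD (@eq_twist c _ (fun i => comm_exp n i.+1)); last first.
  by move=> i; rewrite comm_exp_tail; lia.
apply: bij_on_inj => w; apply: funext => i; rewrite !bij_mulE !twistE !mulgA.
by congr (_ * _); apply: commute_zexpg; apply/commute_sym/Z.
Qed.

Lemma twist_sum c (r : seq nat) (f : nat -> nat -> int) :
  \prod_(j <- r) twist c (f j) = twist c (fun i => \sum_(j <- r) f j i)%R.
Proof.
elim: r => [|j r IHr].
  rewrite big_nil; apply: bij_on_inj => w; apply: funext => i.
  by rewrite twistE big_nil mul1g.
by rewrite big_cons IHr twistD; apply: eq_twist => i; rewrite big_cons.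
Qed.

(** In class two [g^-1, h^a] = [g, h]^(-a), and L_c is the twist of c by F_0, so
    the right-hand side is the twist of [g, h] by - sum_j a_nj dif^j F_0. *)
Lemma shifted_relation n g h : (0 < n)%N ->
  [~ shifted n g, L h] =
  \prod_(1 <= j < n.+1) shifted j [~ g^-1, zexpg h (coefa n j)].
Proof.
move=> n_gt0; set c := [~ g, h].
have cZ b : commute c b by apply: commg_central.
rewrite shifted_comm -/c.
under eq_bigr => j _.
  rewrite commg_zexpg // commVg_class2 // -/c /shifted letterwise_twist.
  rewrite twist_iterJ; last first.
    by move=> b; apply/commute_sym/commute_zexpg/commuteV/commute_sym.
  have -> : twist (zexpg c^-1 (coefa n j)) (iter j dif (fun=> 1%R)) =
            twist c (fun i => - (coefa n j * iter j dif (fun=> 1) i))%R.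
    apply: bij_on_inj => w; apply: funext => i; rewrite !twistE -zexpgM.
    by rewrite zexpgV.
  over.
rewrite twist_sum; apply: eq_twist => i.
by rewrite comm_exp_coefa // sumrN.
Qed.

(** * Faithfulness of normal forms on words *)

Lemma shift_form_tail s w i : (size s <= i)%N -> shift_form P L s w i = w i.
Proof.
elim: s w i => [|g s IHs] // w [|i] //; rewrite [size _]/= ltnS => si.
rewrite -[shift_form _ _ _]/((L g * shift_form P L s) ^ P) conjgE !bij_mulE.
rewrite diff_S !letterwiseE !IHs //; last exact: leqW.
rewrite cayley_bij1S; move: (P w i) => u.
by rewrite invgM -!mulgA !mulKg.
Qed.

(** The form of g :: s is conjugate to L_g u with u the form of s, and u fixes
    the letters from position [size s] on; L_g u = 1 forces g = 1 there. *)
Lemma shift_form_faithful s : shift_form P L s = 1 -> all (pred1 1) s.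
Proof.
elim: s => //= g s IHs /eqP; rewrite conjg_eq1 => /eqP E.
have g1 : g = 1.
  have : (L g * shift_form P L s) (fun=> 1) (size s) = 1 by rewrite E.
  by rewrite bij_mulE letterwiseE shift_form_tail // mulg1.
move: E; rewrite g1 eqxx /= => E; apply: IHs; rewrite -[RHS]E.
rewrite -[LHS]mul1g; congr (_ * _).
by apply: bij_on_inj => w; apply: funext => i; rewrite letterwiseE mul1g.
Qed.

(** Taking differences once moves the last nontrivial letter one place to the
    right and inverts it. *)
Lemma diff_support k w m : w m != 1 -> (forall i, (m < i)%N -> w i = 1) ->
  (P^-1 ^+ k) w (m + k) != 1 /\ forall i, (m + k < i)%N -> (P^-1 ^+ k) w i = 1.
Proof.
move=> wm w1; elim: k => [|k [IH0 IH1]]; first by rewrite expg0 addn0.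
rewrite expgS addnS bij_mulE; split.
  by rewrite diff_S [X in _ * X]IH1 // mulg1 invg_eq1.
by move=> [|i] // ki; rewrite diff_S !IH1 ?mulg1 ?invg1 //; lia.
Qed.

(** Otherwise a nonzero power of x would fix all letters beyond the first
    [size s], which [diff_support] excludes for the word with the single
    nontrivial letter g at position [size s]. *)
Lemma shift_form_torsion g s m n : g != 1 ->
  P ^+ m * shift_form P L s * P ^- n = 1 -> m = n /\ shift_form P L s = 1.
Proof.
move=> g1 E.
have Es : shift_form P L s = P ^- m * P ^+ n.
  by apply: (@mulgI _ (P ^+ m)); apply: (@mulIg _ (P ^- n));
    rewrite E mulKVg mulgV.
pose w : word := fun i => if i == size s then g else 1.
have k0 k : (P^-1 ^+ k) w (size s + k) = w (size s + k) -> k = 0.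
  have [] := @diff_support k w (size s).
  - by rewrite /w eqxx.
  - by move=> i si; rewrite /w ifF //; lia.
  move=> ne _ Ek; move: ne; rewrite Ek /w.
  by case: (_ =P size s) => [|_ /eqP //]; lia.
suff mn : m = n by rewrite mn Es mn mulVg.
case: (leqP m n) => mn.
  have Ek : shift_form P L s * P^-1 ^+ (n - m) = 1.
    by rewrite Es expVgn -{1}(subnKC mn) expgnDr mulKg mulgV.
  suff: n - m = 0 by lia.
  apply: k0; rewrite -[RHS]/((1 : B) w _) -Ek bij_mulE shift_form_tail //; lia.
have Ek : shift_form P L s = P^-1 ^+ (m - n).
  by rewrite Es expVgn -{1}(subnKC (ltnW mn)) expgnDr invgM mulgVK.
suff: m - n = 0 by lia.
by apply: k0; rewrite -Ek shift_form_tail //; lia.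
Qed.

End Words.

(** * Homomorphisms and shift forms *)

Section Morphisms.
Variables (G A : groupType) (f : G -> A).
Hypothesis fM : {morph f : g h / g * h}.

Lemma gmorph1 : f 1 = 1.
Proof. by apply: (@mulgI _ (f 1)); rewrite -fM !mulg1. Qed.

Let bundled : UMagmaMorphism.type G A :=
  HB.pack f (isMultiplicative.Build G A f fM)
            (Multiplicative_isUMagmaMorphism.Build G A f gmorph1).

Lemma gmorphV : {morph f : g / g^-1}.
Proof. exact: gmulfV bundled. Qed.

Lemma gmorphX n : {morph f : g / g ^+ n}.
Proof. exact: gmulfXn bundled n. Qed.

Lemma gmorphJ : {morph f : g h / g ^ h}.
Proof. exact: gmulfJ bundled. Qed.

Lemma gmorphR : {morph f : g h / [~ g, h]}.
Proof. exact: gmulfR bundled. Qed.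

Lemma gmorph_prod (r : seq nat) (F : nat -> G) :
  f (\prod_(j <- r) F j) = \prod_(j <- r) f (F j).
Proof. exact: (gmulf_prod bundled). Qed.

Lemma gmorph_shift_form (H : groupType) p (gam : H -> G) s :
  f (shift_form p gam s) = shift_form (f p) (f \o gam) s.
Proof. by elim: s => [|g s IHs] /=; rewrite ?gmorph1 // gmorphJ fM IHs. Qed.

End Morphisms.

(** * Normal forms from the relations *)

Section NormalForm.
Variables (G A : groupType) (p : A) (gam : G -> A).
Hypothesis gamM : {morph gam : g h / g * h}.
Hypothesis commg_central : forall a b c : G, commute [~ a, b] c.
Hypothesis rel : forall n g h, (0 < n)%N ->
  [~ gam g ^ p ^+ n, gam h] =
  \prod_(1 <= j < n.+1) gam [~ g^-1, zexpg h (coefa n j)] ^ p ^+ j.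
Implicit Types (g h a c : G) (s : seq G) (z : A).

Local Notation gam1 := (gmorph1 gamM).
Local Notation form := (shift_form p gam).

(** For c central all commutators on the right-hand side of the relation, with c
    in place of g or of h, are trivial. *)
Lemma commute_central_shift0 c m a : (forall b, commute c b) ->
  commute (gam c) (gam a ^ p ^+ m) /\ commute (gam c ^ p ^+ m) (gam a).
Proof.
move=> cZ; case: m => [|m].
  by rewrite !expg0 !conjg1 /commute -!gamM cZ.
have trivial_prod (d : nat -> G) : (forall j, d j = 1) ->
    \prod_(1 <= j < m.+2) gam (d j) ^ p ^+ j = 1.
  by move=> d1; apply: big1 => j _; rewrite d1 gam1 conj1g.
split; [apply: commute_sym|]; apply/commgP/eqP; rewrite rel //;
  apply: trivial_prod => j; apply/eqP/commgP.
- exact/commute_zexpg/commute_sym/cZ.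
- by apply/commute_sym/commuteV/commute_sym/cZ.
Qed.

Lemma commute_central_shift c i m a : (forall b, commute c b) ->
  commute (gam c ^ p ^+ i) (gam a ^ p ^+ m).
Proof.
move=> cZ; have conjE k n u : u ^ p ^+ (k + n) = (u ^ p ^+ k) ^ p ^+ n.
  by rewrite expgnDr conjgM.
case: (leqP i m) => im.
  rewrite -(subnK im) conjE /commute -!conjMg.
  by have [-> _] := commute_central_shift0 (m - i) a cZ.
rewrite -(subnK (ltnW im)) conjE /commute -!conjMg.
by have [_ ->] := commute_central_shift0 (i - m) a cZ.
Qed.

Lemma shift_form_cons g s : form (g :: s) = (gam g * form s) ^ p.
Proof. by []. Qed.

Lemma shift_form1 : form [:: 1] = 1.
Proof. by rewrite /= gam1 mul1g conj1g. Qed.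

Lemma shift_form_rcons s a :
  form (rcons s a) = form s * gam a ^ p ^+ (size s).+1.
Proof.
elim: s => [|g s IHs]; first by rewrite /= expg1 mulg1 mul1g.
rewrite rcons_cons !shift_form_cons IHs mulgA [LHS]conjMg.
by rewrite -conjgM -expgSr.
Qed.

(** Padding with a trivial letter, which spares treating the empty form apart. *)
Lemma shift_form_nonempty s : exists g s', form s = form (g :: s').
Proof. by case: s => [|g s]; [exists 1, [::]; rewrite shift_form1|exists g, s]. Qed.

(** The error terms of the collection process: they can be moved anywhere and
    then merged into a form. *)
Definition absorbed z :=
  (forall m a, commute z (gam a ^ p ^+ m)) /\
  forall s, exists s', form s * z = form s'.

Lemma absorbed1 : absorbed 1.
Proof.
by split=> [m a|s]; [apply/commute_sym/commute1 | exists s; rewrite mulg1].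
Qed.

Lemma absorbedM z z' : absorbed z -> absorbed z' -> absorbed (z * z').
Proof.
move=> [zZ zf] [z'Z z'f]; split=> [m a|s].
  by apply: commute_sym; apply: commuteM; apply: commute_sym.
by have [s1 E1] := zf s; have [s2 E2] := z'f s1; exists s2; rewrite mulgA E1.
Qed.

Lemma commute_central_form c s : (forall b, commute c b) ->
  commute (gam c) (form s).
Proof.
move=> cZ; elim/last_ind: s => [|s a IHs]; first exact: commute1.
rewrite shift_form_rcons; apply: commuteM => //.
by have := commute_central_shift 0 (size s).+1 a cZ; rewrite expg0 conjg1.
Qed.

Lemma absorbed_central c j : (forall b, commute c b) ->
  absorbed (gam c ^ p ^+ j.+1).
Proof.
move=> cZ; split=> [m a|]; first exact: commute_central_shift.
elim: j => [|j IHj] s; have [g [s0 ->]] := shift_form_nonempty s.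
  exists ((g * c) :: s0); rewrite expg1 !shift_form_cons -conjMg gamM.
  by rewrite -!mulgA commute_central_form.
have [s' E] := IHj s0; exists (g :: s').
by rewrite expgSr conjgM !shift_form_cons -conjMg -mulgA E.
Qed.

(** As absorbed elements commute with all x^m a x^-m, the commutator can be
    expanded along the factors of the form; by the relations each resulting
    commutator is a product of x^j c x^-j with j > 0 and c a commutator of G. *)
Lemma absorbed_comm s g : absorbed [~ form s, gam g].
Proof.
elim/last_ind: s => [|s a IHs]; first by rewrite comm1g; apply: absorbed1.
rewrite shift_form_rcons; set u := gam a ^ _.
have -> : [~ form s * u, gam g] = [~ form s, gam g] * [~ u, gam g].
  have -> : [~ form s * u, gam g] = [~ form s, gam g] ^ u * [~ u, gam g].
    by rewrite /commg /conjg !invgM !mulgA !(mulgK, mulgVK).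
  by case: IHs => IHs _; rewrite [_ ^ u]conjgE IHs mulKg.
apply: absorbedM => //; rewrite rel //.
rewrite big_nat_cond; apply: big_rec => [|j z /andP[/andP[j0 _] _] Az].
  exact: absorbed1.
case: j j0 => // j _; apply: absorbedM => //; apply: absorbed_central => b.
exact: commg_central.
Qed.

Lemma shift_form_gam s g : exists s', form s * gam g = gam g * form s'.
Proof.
have [_ /(_ s) [s' E]] := absorbed_comm s g.
by exists s'; rewrite commgC -mulgA E.
Qed.

(** The first letter a of the form stands outermost: for j > 0 the new factor
    passes inside the conjugation, and for j = 0 it is moved in front of the
    remaining form by [shift_form_gam] and merged with a. *)
Lemma shift_form_shifted s j g : exists s', form s * gam g ^ p ^+ j.+1 = form s'.
Proof.
elim: j s => [|j IHj] s; have [a [s0 ->]] := shift_form_nonempty s.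
  have [s' E] := shift_form_gam s0 g; exists ((a * g) :: s').
  by rewrite expg1 !shift_form_cons -conjMg gamM -!mulgA E.
have [s' E] := IHj s0; exists (a :: s').
by rewrite expgSr conjgM !shift_form_cons -conjMg -mulgA E.
Qed.

Definition normal_form q := exists m s n, q = p ^+ m * form s * p ^- n.

Lemma normal_form1 : normal_form 1.
Proof. by exists 0, [::], 0; rewrite !expg0 invg1 !mulg1. Qed.

(** When n = 0 the factor p is absorbed by conjugating the form, which prepends
    a trivial letter. *)
Lemma normal_formMp q : normal_form q -> normal_form (q * p).
Proof.
move=> [m [s [[|n] ->]]].
  exists m.+1, (1 :: s), 0; rewrite shift_form_cons gam1 mul1g conjgE expgSr.
  by rewrite !expg0 invg1 !mulg1 -!mulgA mulVKg.
by exists m, s, n; rewrite expgS invgM -!mulgA mulVg mulg1.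
Qed.

Lemma normal_formMVp q : normal_form q -> normal_form (q * p^-1).
Proof.
by move=> [m [s [n ->]]]; exists m, s, n.+1; rewrite expgS invgM -!mulgA.
Qed.

Lemma normal_formMgam q g : normal_form q -> normal_form (q * gam g).
Proof.
move=> [m [s [[|n] ->]]].
  (* gam g * form s' is p * form (g :: s') * p^-1. *)
  have [s' E] := shift_form_gam s g; exists m.+1, (g :: s'), 1%N.
  rewrite expg0 invg1 mulg1 -mulgA E shift_form_cons conjgE expgSr expg1.
  by rewrite -!mulgA mulVKg mulgV mulg1.
have [s' E] := shift_form_shifted s n g; exists m, s', n.+1.
by rewrite -E conjgE -!mulgA mulgV mulg1.
Qed.

End NormalForm.

(** * Universal properties of free products and presentations *)

Section FreeProductLift.
Variables (H K A : groupType) (al : H -> A) (be : K -> A).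
Hypotheses (alM : {morph al : a b / a * b}) (beM : {morph be : a b / a * b}).

Definition word_eval (w : seq (H + K)) : A :=
  foldr (fun l u => match l with inl a => al a | inr b => be b end * u) 1 w.

Lemma word_eval_cat u v : word_eval (u ++ v) = word_eval u * word_eval v.
Proof. by elim: u => [|l u IHu] /=; rewrite ?mul1g // IHu mulgA. Qed.

Lemma word_eval_eq u v : fp_eq u v -> word_eval u = word_eval v.
Proof.
elim=> {u v} [//|u v _ ->|u v w _ -> _ ->|u u' v v' _ E _ E'|||a b|a b] //=.
- by rewrite !word_eval_cat E E'.
- by rewrite (gmorph1 alM) mulg1.
- by rewrite (gmorph1 beM) mulg1.
- by rewrite alM !mulg1.
- by rewrite beM !mulg1.
Qed.

Definition fp_lift (q : free_product H K) : A :=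
  word_eval (generic_quotient.repr q).

Lemma fp_lift_pi u : fp_lift (fp_pi u) = word_eval u.
Proof. by apply: word_eval_eq; apply/fp_piP; rewrite fp_piK. Qed.

Lemma fp_liftM : {morph fp_lift : q r / q * r}.
Proof.
move=> q r; rewrite -(fp_piK q) -(fp_piK r) {1}/mul /= -fp_piM.
by rewrite !fp_lift_pi word_eval_cat.
Qed.

Lemma fp_lift_inl a : fp_lift (fp_inl K a) = al a.
Proof. by rewrite fp_lift_pi /= mulg1. Qed.

Lemma fp_lift_inr b : fp_lift (fp_inr H b) = be b.
Proof. by rewrite fp_lift_pi /= mulg1. Qed.

End FreeProductLift.

Section QuotientLift.
Variables (G A : groupType) (R : G -> Prop) (phi : G -> A).
Hypotheses (phiM : {morph phi : u v / u * v}).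
Hypothesis phiR : forall r, R r -> phi r = 1.

Lemma quo_piE : {morph quo_pi R : u v / u * v}.
Proof. exact: quo_piM. Qed.

Lemma quo_pi_rel r : R r -> quo_pi R r = 1.
Proof.
move=> Rr; apply/esym/quo_piP; rewrite invg1 mul1g.
by apply: Gen_base; exists r, 1; rewrite conjg1.
Qed.

Lemma nclosure_ker y : nclosure R y -> phi y = 1.
Proof.
elim=> {y} [y [r [w [Rr ->]]]||y z _ Ey _ Ez|y _ Ey].
- by rewrite (gmorphJ phiM) phiR // conj1g.
- exact: gmorph1.
- by rewrite phiM Ey Ez mulg1.
- by rewrite (gmorphV phiM) Ey invg1.
Qed.

Definition quo_lift (q : quo_group R) : A := phi (generic_quotient.repr q).

Lemma quo_lift_pi u : quo_lift (quo_pi R u) = phi u.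
Proof.
have /quo_piP/nclosure_ker :
    quo_pi R u = quo_pi R (generic_quotient.repr (quo_pi R u)) by rewrite quo_piK.
by rewrite phiM (gmorphV phiM) => /mulg1_eq; rewrite invgK.
Qed.

Lemma quo_liftM : {morph quo_lift : q r / q * r}.
Proof.
move=> q r; rewrite -(quo_piK q) -(quo_piK r) -quo_piE.
by rewrite !quo_lift_pi phiM.
Qed.

End QuotientLift.

(** * The presentation of the automata group *)

Section CayleyPresentation.
Variable gT : finGroupType.
Hypothesis commg_central : forall a b c : gT, commute [~ a, b] c.
Hypothesis gT_neq1 : exists g : gT, g != 1.

Local Notation F := (free_product inf_cyclic gT).
Local Notation PG := (cayley_presented_group gT).
Local Notation pi := (quo_pi (@cayley_relator gT)).
Local Notation x := (fp_inl gT inf_cyclic_gen : F).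

(** The presented group's counterpart of P, that is x^-1. *)
Definition pres_shift : PG := (pi x)^-1.
Definition pres_letter (g : gT) : PG := pi (fp_inr inf_cyclic g).

Lemma pres_letterM : {morph pres_letter : g h / g * h}.
Proof. by move=> g h; rewrite /pres_letter fp_inrM quo_piE. Qed.

Lemma relator_factorE (A : groupType) (f : F -> A) n g :
  {morph f : u v / u * v} ->
  f (x ^+ n * fp_inr inf_cyclic g * x ^- n) =
  f (fp_inr inf_cyclic g) ^ (f x)^-1 ^+ n.
Proof.
move=> fM; rewrite !fM (gmorphV fM) !(gmorphX fM) expVgn conjgE invgK.
by rewrite mulgA.
Qed.

Lemma pres_rel n g h : (0 < n)%N ->
  [~ pres_letter g ^ pres_shift ^+ n, pres_letter h] =
  \prod_(1 <= j < n.+1)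
    pres_letter [~ g^-1, zexpg h (coefa n j)] ^ pres_shift ^+ j.
Proof.
move=> n0; apply: divg1_eq.
have : pi ([~ x ^+ n * fp_inr inf_cyclic g * x ^- n, fp_inr inf_cyclic h] *
  (\prod_(1 <= j < n.+1)
     (x ^+ j * fp_inr inf_cyclic [~ g^-1, zexpg h (coefa n j)] * x ^- j))^-1) = 1.
  by apply: quo_pi_rel; exists n, g, h.
have piM := @quo_piE _ (@cayley_relator gT).
rewrite piM (gmorphV piM) (gmorphR piM) (gmorph_prod piM).
rewrite (relator_factorE _ _ piM).
by under eq_bigr do rewrite (relator_factorE _ _ piM).
Qed.

Lemma pres_normal_form q : normal_form pres_shift pres_letter q.
Proof.
have Mp := normal_formMp pres_letterM.
have MVp := @normal_formMVp gT PG pres_shift pres_letter.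
have Mx r (k : inf_cyclic) : normal_form pres_shift pres_letter r ->
    normal_form pres_shift pres_letter (r * pi (fp_inl gT k)).
  move=> NFr; elim/int_rect: k => [|n IHn|n IHn].
  - by rewrite (gmorph1 (@fp_inlM inf_cyclic gT)) (gmorph1 (@quo_piE _ _)) mulg1.
  - have -> : (Posz n.+1 : inf_cyclic) = (Posz n : inf_cyclic) * inf_cyclic_gen.
      by rewrite -addn1.
    rewrite fp_inlM quo_piE mulgA; have := MVp _ IHn.
    by rewrite /pres_shift invgK.
  have -> : (- (Posz n.+1) : inf_cyclic)%R =
            ((- Posz n)%R : inf_cyclic) * inf_cyclic_gen^-1.
    by rewrite -[RHS]/(- Posz n + - 1)%R; lia.
  rewrite fp_inlM (gmorphV (@fp_inlM inf_cyclic gT) inf_cyclic_gen) quo_piE.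
  by rewrite (gmorphV (@quo_piE _ _) x) mulgA; apply: Mp IHn.
rewrite -(quo_piK q) -(fp_piK (generic_quotient.repr q)).
move: (generic_quotient.repr (generic_quotient.repr q)) => w.
elim/last_ind: w => [|w l IHw].
  by rewrite [X in normal_form _ _ X](gmorph1 (@quo_piE _ _)); apply: normal_form1.
have -> : fp_pi (rcons w l) = fp_pi w * (fp_pi [:: l] : F).
  by rewrite -cats1 fp_piM.
rewrite quo_piE; case: l => [k|g]; first exact: Mx.
exact: (normal_formMgam pres_letterM commg_central pres_rel).
Qed.

Local Notation CA := (cayley_automata_group gT).
Local Notation gens := (fun f : bij_on (omega_word gT) => exists g, f = cayley_bij g).

Fact cayley_bij1_gen : (cayley_bij 1 : bij_on (omega_word gT)) \in gen_pred gens.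
Proof. by apply/asboolP/Gen_base; exists 1. Qed.

Fact letterwise_gen (g : gT) : letterwise g \in gen_pred gens.
Proof.
apply/asboolP; rewrite -[letterwise g](mulgK (cayley_bij (1 : gT))) -cayley_bijE.
by apply: Gen_mul; [|apply: Gen_inv]; apply: Gen_base; eexists.
Qed.

Definition aut_cayley : CA := GenGroup cayley_bij1_gen.
Definition aut_letter (g : gT) : CA := GenGroup (letterwise_gen g).

Lemma gen_valM : {morph (@gen_val _ gens : CA -> _) : u v / u * v}.
Proof. by []. Qed.

Lemma gen_val_inj : injective (@gen_val _ gens).
Proof. exact: val_inj. Qed.

Lemma aut_letterM : {morph aut_letter : g h / g * h}.
Proof. by move=> g h; apply: val_inj; apply: letterwiseM. Qed.

Definition aut_power (k : inf_cyclic) : CA := zexpg aut_cayley^-1 k.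

Lemma aut_powerM : {morph aut_power : k l / k * l}.
Proof. by move=> k l; apply: zexpgD. Qed.

Definition free_to_aut : F -> CA := fp_lift aut_power aut_letter.

Lemma free_to_autM : {morph free_to_aut : u v / u * v}.
Proof. exact: fp_liftM aut_powerM aut_letterM. Qed.

Lemma free_to_aut_x : free_to_aut x = aut_cayley^-1.
Proof. exact: (fp_lift_inl aut_powerM aut_letterM). Qed.

Lemma free_to_aut_letter g : free_to_aut (fp_inr inf_cyclic g) = aut_letter g.
Proof. exact: (fp_lift_inr aut_powerM aut_letterM). Qed.

Lemma aut_rel n g h : (0 < n)%N ->
  [~ aut_letter g ^ aut_cayley ^+ n, aut_letter h] =
  \prod_(1 <= j < n.+1)
    aut_letter [~ g^-1, zexpg h (coefa n j)] ^ aut_cayley ^+ j.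
Proof.
move=> n0; apply: gen_val_inj.
rewrite (gmorphR gen_valM) (gmorph_prod gen_valM).
rewrite (gmorphJ gen_valM) (gmorphX gen_valM).
under [RHS]eq_bigr do rewrite (gmorphJ gen_valM) (gmorphX gen_valM).
exact: shifted_relation.
Qed.

Lemma free_to_aut_relator r : cayley_relator r -> free_to_aut r = 1.
Proof.
move=> [n [g [h [n0 ->]]]].
rewrite free_to_autM (gmorphV free_to_autM) (gmorphR free_to_autM).
rewrite (gmorph_prod free_to_autM) (relator_factorE _ _ free_to_autM).
under eq_bigr do
  rewrite (relator_factorE _ _ free_to_autM) free_to_aut_x invgK free_to_aut_letter.
by rewrite !free_to_aut_letter free_to_aut_x invgK aut_rel // mulgV.
Qed.

Definition pres_to_aut : PG -> CA := quo_lift free_to_aut.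

Lemma pres_to_autM : {morph pres_to_aut : q r / q * r}.
Proof. exact: quo_liftM free_to_autM free_to_aut_relator. Qed.

Lemma pres_to_aut_pi u : pres_to_aut (pi u) = free_to_aut u.
Proof. exact: quo_lift_pi free_to_autM free_to_aut_relator _. Qed.

Lemma pres_to_aut_shift : pres_to_aut pres_shift = aut_cayley.
Proof. by rewrite (gmorphV pres_to_autM) pres_to_aut_pi free_to_aut_x invgK. Qed.

Lemma pres_to_aut_letter g : pres_to_aut (pres_letter g) = aut_letter g.
Proof. by rewrite pres_to_aut_pi free_to_aut_letter. Qed.

Lemma pres_to_aut_ker q : pres_to_aut q = 1 -> q = 1.
Proof.
have [g g1] := gT_neq1; have [m [s [n ->]]] := pres_normal_form q.
rewrite !pres_to_autM (gmorphV pres_to_autM) !(gmorphX pres_to_autM).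
rewrite (gmorph_shift_form pres_to_autM) pres_to_aut_shift.
have -> : pres_to_aut \o pres_letter = aut_letter.
  by apply: funext => h; apply: pres_to_aut_letter.
move/(congr1 (@gen_val _ gens)).
rewrite !gen_valM (gmorphV gen_valM) !(gmorphX gen_valM).
rewrite (gmorph_shift_form gen_valM) (gmorph1 gen_valM).
case/(shift_form_torsion g1) => -> /shift_form_faithful s1.
suff -> : shift_form pres_shift pres_letter s = 1 by rewrite mulg1 mulgV.
elim: s s1 => //= h s IHs /andP[/eqP-> /IHs->].
by rewrite (gmorph1 pres_letterM) mulg1 conj1g.
Qed.

Lemma pres_to_aut_surj u : exists q, pres_to_aut q = u.
Proof.
case: u => f Gf; have [q Eq] : exists q, gen_val (pres_to_aut q) = f; last first.
  by exists q; apply: val_inj.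
move/asboolP: Gf; elim=> {f} [f [g ->]||f f' _ [q <-] _ [q' <-]|f _ [q <-]].
- exists (pres_letter g * pres_shift).
  by rewrite pres_to_autM pres_to_aut_shift pres_to_aut_letter cayley_bijE.
- by exists 1; rewrite (gmorph1 pres_to_autM).
- by exists (q * q'); rewrite pres_to_autM.
- by exists q^-1; rewrite (gmorphV pres_to_autM).
Qed.

Lemma pres_to_aut_bij : bijective pres_to_aut.
Proof.
have [inv invP] := choice pres_to_aut_surj.
exists inv => // q; apply: divg1_eq; apply: pres_to_aut_ker.
by rewrite pres_to_autM (gmorphV pres_to_autM) invP mulgV.
Qed.

HB.instance Definition _ := isMultiplicative.Build PG CA pres_to_aut pres_to_autM.

Lemma cayley_presentation : exists f : {multiplicative PG -> CA}, bijective f.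
Proof. by exists pres_to_aut; apply: pres_to_aut_bij. Qed.

End CayleyPresentation.

Theorem theorem1p1 (gT : finGroupType) :
  nilpotent [set: gT] -> nil_class [set: gT] = 2 ->
  exists f : {multiplicative cayley_presented_group gT
                             -> cayley_automata_group gT}, bijective f.
Proof.
move=> _ cl2; apply: cayley_presentation => [a b c|].
  have /subsetP/(_ [~ a, b])/(_ _)/setIP[|_ /centP] :
      [set: gT]^`(1) \subset 'Z([set: gT]).
  - by rewrite -nil_class2 cl2.
  - by rewrite mem_commg ?in_setT.
  by apply; rewrite in_setT.
have : [set: gT] != 1%g by rewrite -nil_class0 cl2.
by case/trivgPn => g _ g1; exists g.
Qed.
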